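(* For every integer $n\geq 1$, $$A_{O>N}(n)-B_{O>N}(n)=H'_{ON}(n).$$
   Context: A partition of $n$ is a finite non-increasing sequence of positive integers (its parts) with sum $n$. An overpartition of $n$ is a partition of $n$ in which the first occurrence of each number may be overlined (so for each size $t$ at most one part of size $t$ is overlined); the size of a part $t$ or $\overline{t}$ is $t$, and the weight is the sum of sizes. For an overpartition $\pi$, let $LN(\pi)$ (resp. $SN(\pi)$) be the size of the largest (resp. smallest) non-overlined part of $\pi$ if $\pi$ has non-overlined parts, and $LN(\pi)=0$ (resp. $SN(\pi)=0$) otherwise. Let $LO(\pi)$ be the size of the largest overlined part of $\pi$ if $\pi$ has overlined parts, and $LO(\pi)=0$ otherwise. Let $\ell_{O>N}(\pi)$ be the number of overlined parts of $\pi$ of size greater than $SN(\pi)$. $A_{O>N}(n)$ (resp. $B_{O>N}(n)$) is the number of overpartitions $\pi$ of $n$ such that $SN(\pi)\geq 1$ and $\ell_{O>N}(\pi)$ is even (resp. odd). $\mathcal{E}_O^{N}$ is the set of overpartitions in which non-overlined parts must appear and the sizes of non-overlined parts are greater than or equal to those of overlined parts, i.e. $SN(\pi)\geq 1$ and $SN(\pi)\geq LO(\pi)$. $H'_{ON}(n)$ is the number of overpartitions $\pi$ of $n$ in $\mathcal{E}_O^{N}$ with $LN(\pi)=SN(\pi)$. *)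

(* Defs.v *)
From HB Require Import structures.
From mathcomp Require Import all_boot all_order all_algebra.

Set Implicit Arguments.
Unset Strict Implicit.
Unset Printing Implicit Defensive.

(* A part is a pair [(t, b)]: [t] is its size and [b] tells whether it is
   overlined.  A sequence of parts lists them in non-increasing order of size;
   [index t s == i] says that position [i] is the first occurrence of [t], so
   the last conjunct only lets first occurrences be overlined. *)
Definition part := (nat * bool)%type.

Definition sizes (p : seq part) : seq nat := [seq x.1 | x <- p].
Definition marks (p : seq part) : seq bool := [seq x.2 | x <- p].

Definition is_overpartition (n : nat) (p : seq part) : bool :=
  [&& sorted geq (sizes p),
      all (leq 1) (sizes p),
      sumn (sizes p) == n
    & all (fun i => nth false (marks p) i ==>
                    (index (nth 0 (sizes p) i) (sizes p) == i))
          (iota 0 (size p))].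

Record overpartition (n : nat) := Overpartition {
  parts :> seq part;
  _ : is_overpartition n parts
}.

HB.instance Definition _ n := [isSub for @parts n].
HB.instance Definition _ n := [Countable of overpartition n by <:].

(* Finiteness: an overpartition of [n] has at most [n] parts, each of size at
   most [n]. *)
Section Finiteness.
Variable n : nat.

Definition bounded_code := n.-bseq ('I_n.+1 * bool)%type.

Lemma size_overpartition (p : overpartition n) :
  size [seq (inord x.1 : 'I_n.+1, x.2) | x <- p] <= n.
Proof.
case: p => s /= /and4P[_ pos /eqP <- _]; rewrite size_map.
elim: s pos => //= x s IHs /andP[x_gt0 /IHs le_s].
by rewrite -add1n leq_add.
Qed.

Definition encode (p : overpartition n) : bounded_code :=
  Bseq (size_overpartition p).

Definition decode (c : bounded_code) : option (overpartition n) :=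
  insub [seq (nat_of_ord x.1, x.2) | x <- c].

Lemma encodeK : pcancel encode decode.
Proof.
move=> p; rewrite /decode /= -map_comp map_id_in ?valK //.
case: p => s /= /and4P[_ _ /eqP <- _] [t b] s_tb /=.
rewrite inordK // ltnS.
elim: s s_tb => //= x s IHs; rewrite inE => /predU1P[<-|/IHs le_t] /=.
  exact: leq_addr.
exact: leq_trans le_t (leq_addl _ _).
Qed.

HB.instance Definition _ :=
  isFinite.Build (overpartition n) (pcan_enumP encodeK).

End Finiteness.

Definition nonoverlined (p : seq part) : seq nat :=
  [seq x.1 | x <- p & ~~ x.2].
Definition overlined (p : seq part) : seq nat :=
  [seq x.1 | x <- p & x.2].

(* The maximum over an empty sequence is 0. *)
Definition LN (p : seq part) : nat := \max_(t <- nonoverlined p) t.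
Definition LO (p : seq part) : nat := \max_(t <- overlined p) t.
Definition SN (p : seq part) : nat :=
  if nonoverlined p is t :: r then \big[minn/t]_(u <- r) u else 0.

Definition ell_OgtN (p : seq part) : nat :=
  count (fun t => SN p < t) (overlined p).

Definition A_OgtN (n : nat) : nat :=
  #|[set p : overpartition n | (1 <= SN p) && ~~ odd (ell_OgtN p)]|.

Definition B_OgtN (n : nat) : nat :=
  #|[set p : overpartition n | (1 <= SN p) && odd (ell_OgtN p)]|.

Definition E_ON (p : seq part) : bool := (1 <= SN p) && (LO p <= SN p).

Definition H'_ON (n : nat) : nat :=
  #|[set p : overpartition n | E_ON p && (LN p == SN p)]|.

(* Main.v *)
Require Import Defs.
From mathcomp Require Import all_boot all_order all_algebra.

(** Parts are listed in non-increasing order, so the head is a first occurrence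
    of the largest size [t] and its mark can be toggled freely.  When
    [SN p < t], toggling keeps [SN p] and changes the number of overlined parts
    above [SN p] by one.  The overpartitions that escape this sign-reversing
    involution have all sizes at most [SN p]; these are the ones counted by
    [H'_ON], and they have no overlined part above [SN p]. *)

Set Implicit Arguments.
Unset Strict Implicit.
Unset Printing Implicit Defensive.

Definition toggle_head (p : seq part) : seq part :=
  if p is (t, b) :: r then (t, ~~ b) :: r else [::].

Definition head_size (p : seq part) : nat := head 0 (sizes p).

Lemma toggle_headK : involutive toggle_head.
Proof. by case=> [|[t b] r] //=; rewrite negbK. Qed.

Lemma head_size_toggle p : head_size (toggle_head p) = head_size p.
Proof. by case: p => [|[]]. Qed.

Lemma is_overpartition_toggle n p :
  is_overpartition n p -> is_overpartition n (toggle_head p).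
Proof.
case: p => [|[t b] r] //; rewrite /is_overpartition /=.
case/and5P=> -> -> -> _ /allP r_marks; rewrite eqxx implybT /=.
apply/allP=> i i_r; have := r_marks i i_r.
by case: i i_r => //; rewrite mem_iota.
Qed.

(** [minn] has no neutral element on [nat], so [SN] starts its minimum at the first non-overlined
    size; extracting that start gives [SN] a recursion. *)
Lemma bigminn_idx a b (s : seq nat) :
  \big[minn/minn a b]_(x <- s) x = minn a (\big[minn/b]_(x <- s) x).
Proof.
by elim: s => [|x s IHs]; rewrite ?big_nil // !big_cons IHs minnCA.
Qed.

Lemma SN_cons t b r :
  SN ((t, b) :: r) =
  if b then SN r else if nilp (nonoverlined r) then t else minn t (SN r).
Proof.
case: b => //; rewrite /SN /nonoverlined /=.
case: [seq x.1 | x <- r & ~~ x.2] => [|u s] /=; first by rewrite big_nil.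
by rewrite big_cons -!bigminn_idx minnC.
Qed.

Lemma SN_toggle p :
  0 < SN p < head_size p -> SN (toggle_head p) = SN p.
Proof.
case: p => [|[t b] r] //; rewrite /head_size /= !SN_cons.
(* With a non-overlined part in [r], the bound forces [SN r < t], so [t] never affects the minimum.
   Without one, [SN p] is [0] or [t], both excluded. *)
case: nilP => [r0|_]; last first.
  by case: b => /= /andP[_]; rewrite ?gtn_min ?ltnn //= => /ltnW/minn_idPr.
by case: b; rewrite /= ?ltnn ?andbF // /SN r0.
Qed.

Lemma odd_ell_toggle p : 0 < SN p < head_size p ->
  odd (ell_OgtN (toggle_head p)) = ~~ odd (ell_OgtN p).
Proof.
(* Both counts now share one threshold, so they differ only at the head. *)
move=> SNp; rewrite /ell_OgtN SN_toggle //; move: SNp.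
case: p => [|[t b] r] //; rewrite /head_size /= => /andP[_ lt_t].
by case: b lt_t => lt_t; rewrite /overlined /= lt_t //= negbK.
Qed.

Lemma leq_head_size n (p : overpartition n) x : x \in val p -> x.1 <= head_size p.
Proof.
case: p => -[|y r] //= /and4P[/= r_sorted _ _ _].
rewrite inE => /predU1P[-> //|xr].
have geq_trans : transitive geq by move=> b a c ab bc; apply: leq_trans bc ab.
by apply: (allP (order_path_min geq_trans r_sorted)); apply: map_f.
Qed.

Lemma SN_leq_LN p : SN p <= LN p.
Proof.
rewrite /SN /LN; case: (nonoverlined p) => [|t s] //; rewrite big_cons.
apply: leq_trans (leq_maxl _ _).
by elim: s => [|x s IHs]; rewrite ?big_nil // big_cons geq_min IHs orbT.
Qed.

Lemma head_size_leq p : 0 < head_size p -> head_size p <= maxn (LO p) (LN p).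
Proof.
case: p => [|[t b] r] // _; rewrite /LO /LN /head_size /overlined /nonoverlined.
by case: b; rewrite /= big_cons leq_max leq_maxl ?orbT.
Qed.

(** As [SN p <= LN p], the left side bounds [maxn (LO p) (LN p)], the largest size, by [SN p]. *)
Lemma E_ON_LN_eq_SN n (p : overpartition n) :
  E_ON p && (LN p == SN p) = (0 < SN p) && (head_size p <= SN p).
Proof.
rewrite /E_ON -andbA; case: (ltnP 0 (SN p)) => //= SN_gt0.
rewrite eqn_leq SN_leq_LN andbT -geq_max.
apply/idP/idP => [le_SN|head_le].
  case: (posnP (head_size p)) => [-> //|/head_size_leq le_head].
  exact: leq_trans le_head le_SN.
rewrite geq_max; apply/andP; split; apply/bigmax_leqP_seq => t /mapP[x + ->] _.
  by rewrite mem_filter => /andP[_ /leq_head_size le_x]; apply: leq_trans head_le.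
by rewrite mem_filter => /andP[_ /leq_head_size le_x]; apply: leq_trans head_le.
Qed.

Lemma ell_eq0 n (p : overpartition n) : head_size p <= SN p -> ell_OgtN p = 0.
Proof.
move=> head_le; apply/eqP; rewrite -leqn0 leqNgt -has_count.
apply/hasPn => t /mapP[x + ->]; rewrite mem_filter => /andP[_ /leq_head_size].
by rewrite -leqNgt => le_x; apply: leq_trans head_le.
Qed.

Definition toggle n (p : overpartition n) : overpartition n :=
  Overpartition (is_overpartition_toggle (valP p)).

Lemma toggleK n : involutive (@toggle n).
Proof. by move=> p; apply: val_inj; apply: toggle_headK. Qed.

Lemma mem_B_toggle n (p : overpartition n) :
  (0 < SN (toggle p)) && odd (ell_OgtN (toggle p)) =
  [&& 0 < SN p, ~~ odd (ell_OgtN p) & SN p < head_size p].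
Proof.
apply/andP/and3P => [[SN_gt0 odd_ell]|[SN_gt0 even_ell SN_lt]]; last first.
  by rewrite SN_toggle ?odd_ell_toggle ?SN_gt0.
have SN_lt : SN (toggle p) < head_size (toggle p).
  (* An odd count is nonzero. *)
  by rewrite ltnNge; apply: contraL odd_ell => /ell_eq0 ->.
have SN_bd : 0 < SN (toggle p) < head_size (toggle p) by rewrite SN_gt0.
(* Reading [p] as the toggle of [toggle p] reuses the forward lemmas. *)
rewrite -[p]toggleK SN_toggle // odd_ell_toggle // negbK.
by rewrite head_size_toggle.
Qed.

Lemma A_OgtN_split n : A_OgtN n = H'_ON n + B_OgtN n.
Proof.
rewrite /B_OgtN -(card_preimset _ (inv_inj (@toggleK n))).
(* Inside this set lie the overpartitions counted by [H'_ON]; outside it, the preimage under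
   [toggle] of those counted by [B_OgtN]. *)
rewrite /A_OgtN -(cardsID [set p : overpartition n | head_size p <= SN p]).
congr (_ + _); apply: eq_card => p; rewrite !inE ?E_ON_LN_eq_SN.
  by case: (leqP (head_size p) (SN p)) => [/ell_eq0 ->|_]; rewrite ?andbT ?andbF.
by rewrite mem_B_toggle -ltnNge andbC andbA.
Qed.

Local Open Scope ring_scope.

Theorem theorem2p13 (n : nat) (hn : (1 <= n)%N) :
  (A_OgtN n)%:Z - (B_OgtN n)%:Z = (H'_ON n)%:Z.
Proof. by rewrite A_OgtN_split PoszD GRing.addrK. Qed.
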